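(* Let $A$ be a set of actions containing $\tau$ and $(S,\to)$ a labelled transition system with labels from $A$. Then the relation $\simeq_{D_3}$ on $S$ (defined in the context) is an equivalence relation.
   Context: $s\xrightarrow{a}s'$ means $(s,a,s')\in\to$; $s\xrightarrow{(a)}s'$ means ''$s\xrightarrow{a}s'$, or ($a=\tau$ and $s=s'$)''; $\twoheadrightarrow$ is the reflexive–transitive closure of $\xrightarrow{\tau}$; $\omega=\{0,1,\dots\}$. For a binary relation $R$ on $S$: (T) if $sRt$ and $s\xrightarrow{a}s'$, then there are $t'',t'$ with $t\twoheadrightarrow t''\xrightarrow{(a)}t'$, $sRt''$ and $s'Rt'$. (D$_3$) if $sRt$ and $(s_k)_{k\in\omega}$ is an infinite sequence with $s=s_0$ and $s_k\xrightarrow{\tau}s_{k+1}$ for all $k$, then there are an infinite sequence $(t_\ell)_{\ell\in\omega}$ and a map $\sigma:\omega\to\omega$ with $t=t_0$, $t_\ell\xrightarrow{\tau}t_{\ell+1}$ and $s_{\sigma(\ell)}Rt_\ell$ for all $\ell$. $s\simeq_{D_3}t$ iff there is a symmetric relation $R$ satisfying (T) and (D$_3$) with $sRt$. *)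

(* Defs.v *)
From Stdlib Require Export Relations.

Section LTS.

Context {A : Type} (tau : A) {State : Type} (trans : State -> A -> State -> Prop).

Definition opt_step (s : State) (a : A) (s' : State) : Prop :=
  trans s a s' \/ (a = tau /\ s = s').

Definition tau_steps : relation State :=
  clos_refl_trans State (fun s s' => trans s tau s').

Definition cond_T (R : relation State) : Prop :=
  forall s t a s', R s t -> trans s a s' ->
    exists t'' t', tau_steps t t'' /\ opt_step t'' a t' /\ R s t'' /\ R s' t'.

(* The map sigma is arbitrary: no monotonicity is required. *)
Definition cond_D3 (R : relation State) : Prop :=
  forall s t (u : nat -> State), R s t ->
    s = u 0 -> (forall k, trans (u k) tau (u (S k))) ->
    exists (v : nat -> State) (sigma : nat -> nat),
      t = v 0 /\ (forall l, trans (v l) tau (v (S l)) /\ R (u (sigma l)) (v l)).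

Definition bisim_D3 : relation State := fun s t =>
  exists R : relation State,
    symmetric State R /\ cond_T R /\ cond_D3 R /\ R s t.

End LTS.

(* Main.v *)
(** Since [cond_T] allows a [tau]-step to be matched by staying put after some
    [tau]-steps, it is preserved by relational composition; so is [cond_D3],
    because the index maps are arbitrary and hence compose. Composing the
    largest bisimulation [bisim_D3] with itself therefore gives a bisimulation,
    symmetric because [bisim_D3] is, which yields transitivity. *)
Require Import Defs.

Section Bisimulation.

Context {A : Type} (tau : A) {State : Type} (trans : State -> A -> State -> Prop).

Definition compose (R1 R2 : relation State) : relation State :=
  fun s u => exists t, R1 s t /\ R2 t u.

Lemma opt_step_tau_steps s s' :
  opt_step tau trans s tau s' -> tau_steps tau trans s s'.
Proof.
  intros [H | [_ <-]]; [now apply rt_step | apply rt_refl].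
Qed.

(** Each single [tau]-step is answered by a [tau]-path followed by an optional [tau]-step, which is
    again a [tau]-path; induction concatenates these. In a composition, this lets the second
    relation follow the [tau]-path with which the first one answers. *)
Lemma cond_T_tau_steps (R : relation State) :
  cond_T tau trans R ->
  forall s s', tau_steps tau trans s s' ->
  forall t, R s t -> exists t', tau_steps tau trans t t' /\ R s' t'.
Proof.
  intros HT s s' Hs.
  induction Hs as [s s' Hs | s | s s1 s2 _ IH1 _ IH2]; intros t Hst.
  - destruct (HT _ _ _ _ Hst Hs) as (t'' & t' & Ht & Ho & _ & HR).
    exists t'; split; [|exact HR].
    apply rt_trans with t''; [exact Ht | now apply opt_step_tau_steps].
  - exists t; split; [apply rt_refl | exact Hst].
  - destruct (IH1 _ Hst) as (t1 & Ht1 & HR1).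
    destruct (IH2 _ HR1) as (t2 & Ht2 & HR2).
    exists t2; split; [now apply rt_trans with t1 | exact HR2].
Qed.

Lemma cond_T_compose (R1 R2 : relation State) :
  cond_T tau trans R1 -> cond_T tau trans R2 ->
  cond_T tau trans (compose R1 R2).
Proof.
  intros H1 H2 s u a s' (t & Hst & Htu) Hs.
  destruct (H1 _ _ _ _ Hst Hs) as (t'' & t' & Ht & Ho & HR1 & HR1').
  destruct (cond_T_tau_steps R2 H2 _ _ Ht _ Htu) as (u1 & Hu1 & Htu1).
  destruct Ho as [Ho | [-> <-]].
  - destruct (H2 _ _ _ _ Htu1 Ho) as (u'' & u' & Hu & Ho' & HR2 & HR2').
    exists u'', u'; repeat split.
    + now apply rt_trans with u1.
    + exact Ho'.
    + now exists t''.
    + now exists t'.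
  (* The middle state idles, so [s] and [s'] are both related to [t'']; hence [u1] can idle as
     well. *)
  - exists u1, u1; repeat split.
    + exact Hu1.
    + right; now split.
    + now exists t''.
    + now exists t''.
Qed.

Lemma cond_D3_compose (R1 R2 : relation State) :
  cond_D3 tau trans R1 -> cond_D3 tau trans R2 ->
  cond_D3 tau trans (compose R1 R2).
Proof.
  intros H1 H2 s u ss (t & Hst & Htu) Hs0 Hss.
  destruct (H1 _ _ ss Hst Hs0 Hss) as (ts & sigma & Ht0 & Hts).
  destruct (H2 _ _ ts Htu Ht0 (fun l => proj1 (Hts l)))
    as (us & rho & Hu0 & Hus).
  (* The middle state linking [ss (sigma (rho l))] to [us l] is [ts (rho l)]. *)
  exists us, (fun l => sigma (rho l)); split; [exact Hu0 | intros l; split].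
  - apply Hus.
  - exists (ts (rho l)); split; [apply Hts | apply Hus].
Qed.

(** Reversal swaps the two factors, so equal factors are taken: composing two different symmetric
    relations need not give a symmetric one. *)
Lemma compose_symmetric (R : relation State) :
  symmetric State R -> symmetric State (compose R R).
Proof.
  intros HR s u (t & Hst & Htu); exists t; split; now apply HR.
Qed.

Lemma bisim_D3_refl : reflexive State (bisim_D3 tau trans).
Proof.
  intros s; exists eq; repeat split.
  - intros x y; apply eq_sym.
  - intros x y a x' <- Hx; exists x, x'; repeat split.
    + apply rt_refl.
    + now left.
  - intros x y u <- H0 Hu; exists u, (fun l => l); now repeat split.
Qed.

Lemma bisim_D3_sym : symmetric State (bisim_D3 tau trans).
Proof.
  intros s t (R & HS & HT & HD & HR); exists R; repeat split; auto.
Qed.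

(** [bisim_D3] is the union of all its witnesses [R], and an answer found within one [R] stays valid
    in the union. *)
Lemma bisim_D3_cond_T : cond_T tau trans (bisim_D3 tau trans).
Proof.
  intros s t a s' (R & HS & HT & HD & HR) Hs.
  destruct (HT _ _ _ _ HR Hs) as (t'' & t' & Ht & Ho & HR1 & HR2).
  exists t'', t'; repeat split; auto; now exists R.
Qed.

Lemma bisim_D3_cond_D3 : cond_D3 tau trans (bisim_D3 tau trans).
Proof.
  intros s t u (R & HS & HT & HD & HR) H0 Hu.
  destruct (HD _ _ u HR H0 Hu) as (v & sigma & Hv0 & Hv).
  exists v, sigma; split; [exact Hv0 | intros l; split; [apply Hv |]].
  exists R; repeat split; auto; apply Hv.
Qed.

Lemma bisim_D3_trans : transitive State (bisim_D3 tau trans).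
Proof.
  intros s t u Hst Htu.
  exists (compose (bisim_D3 tau trans) (bisim_D3 tau trans)); repeat split.
  - apply compose_symmetric, bisim_D3_sym.
  - apply cond_T_compose; apply bisim_D3_cond_T.
  - apply cond_D3_compose; apply bisim_D3_cond_D3.
  - now exists t.
Qed.

End Bisimulation.

Theorem theorem1 (A : Type) (tau : A) (State : Type)
    (trans : State -> A -> State -> Prop) :
  equivalence State (bisim_D3 tau trans).
Proof.
  split.
  - apply bisim_D3_refl.
  - apply bisim_D3_trans.
  - apply bisim_D3_sym.
Qed.
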